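(* Let $a\in\{5,6,7,8\}$ and $b\ge 12$ be integers, and let $G_{a,b}=P_a\,\Box\,P_b$ be the grid graph. Then $\mathcal{PD}^{TJ}(G_{a,b})$ is disconnected.
   Context: Graphs are finite and simple. $P_m$ is the path with $m$ vertices and $\Box$ denotes the Cartesian product of graphs. For a graph $G$ and a non-empty $S\subseteq V(G)$ define $P^0[S]=S$, $P^1[S]=N[S]$ (the union of the closed neighborhoods of vertices of $S$), and for $i\ge 2$, $P^i[S]=P^{i-1}[S]\cup\{u: N_G(v)\setminus P^{i-1}[S]=\{u\}\text{ for some }v\in P^{i-1}[S]\}$. $S$ is a power dominating set if $P^t[S]=V(G)$ for some $t$; it is minimum if it has the smallest cardinality among power dominating sets. The token jumping (TJ) reconfiguration graph $\mathcal{PD}^{TJ}(G)$ has as vertices all minimum power dominating sets of $G$, with $S$ and $S'$ adjacent if and only if $S$ is obtained from $S'$ by exchanging a single vertex, i.e. $|S\setminus S'|=|S'\setminus S|=1$. *)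

(* Defs.v *)
From mathcomp Require Import all_boot.

Set Implicit Arguments.
Unset Strict Implicit.
Unset Printing Implicit Defensive.

Record sgraph := SGraph {
  vertex : finType;
  edge : rel vertex;
  edge_sym : symmetric edge;
  edge_irrefl : irreflexive edge }.

Coercion vertex : sgraph >-> Finite.type.

Definition connected (G : sgraph) : Prop :=
  forall x y : G, connect (@edge G) x y.

(* Holds iff two vertices are joined by no walk; the graph with no vertices is
   not disconnected. *)
Definition disconnected (G : sgraph) : Prop := ~ connected G.

Section PathGraph.
Variable n : nat.

Definition path_edge : rel 'I_n := [rel i j : 'I_n | (i.+1 == j) || (j.+1 == i)].

Lemma path_edge_sym : symmetric path_edge.
Proof. by move=> i j; rewrite /path_edge /= orbC. Qed.

Lemma path_edge_irrefl : irreflexive path_edge.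
Proof. by move=> i; rewrite /path_edge /= orbb gtn_eqF. Qed.

Definition path_graph : sgraph := SGraph path_edge_sym path_edge_irrefl.
End PathGraph.

Section CartesianProduct.
Variables G H : sgraph.

Definition cart_edge : rel (G * H) :=
  [rel x y : G * H | (x.1 == y.1) && edge x.2 y.2 || (x.2 == y.2) && edge x.1 y.1].

Lemma cart_edge_sym : symmetric cart_edge.
Proof.
move=> x y; rewrite /cart_edge /= (edge_sym x.1) (edge_sym x.2).
by rewrite (eq_sym x.1) (eq_sym x.2).
Qed.

Lemma cart_edge_irrefl : irreflexive cart_edge.
Proof. by move=> x; rewrite /cart_edge /= !edge_irrefl !andbF. Qed.

Definition cart_prod : sgraph := SGraph cart_edge_sym cart_edge_irrefl.
End CartesianProduct.

Definition grid (a b : nat) : sgraph :=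
  cart_prod (path_graph a) (path_graph b).

Section PowerDomination.
Variable G : sgraph.
Implicit Types (S T : {set G}) (u v : G).

Definition neigh v : {set G} := [set u | edge v u].

Definition closed_neigh v : {set G} := v |: neigh v.

Definition propagate S : {set G} :=
  S :|: [set u | [exists v in S, neigh v :\: S == [set u]]].

(* P^i[S] *)
Fixpoint monitored S (i : nat) : {set G} :=
  match i with
  | 0 => S
  | 1 => \bigcup_(v in S) closed_neigh v
  | j.+1 => propagate (monitored S j)
  end.

(* Bounding t by #|G| only serves to make the predicate boolean, see
   power_dominatingP. *)
Definition power_dominating S : bool :=
  (S != set0) && [exists t : 'I_#|G|.+1, monitored S t == [set: G]].

Lemma monitored_sub S i : monitored S i \subset monitored S i.+1.
Proof.
case: i => [|i]; last exact: subsetUl.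
by apply/subsetP=> v vS; apply/bigcupP; exists v; rewrite ?setU11.
Qed.

Lemma monitored_growth S i : S != set0 ->
  i < #|monitored S i| \/ forall j, i <= j -> monitored S j = monitored S i.
Proof.
move=> S0; elim: i => [|i [ltiS|stab]]; first by left; rewrite card_gt0.
- have := monitored_sub S i; rewrite subEproper => /orP[/eqP eqS|/proper_card].
    case: i => [|i] in ltiS eqS *; last first.
      right=> j /subnK<-; elim: (j - _) => // k IH.
      rewrite addnS in IH; rewrite addSn addnS.
      rewrite -[LHS]/(propagate (monitored S (k + i.+1).+1)) IH.
      by rewrite -[RHS]/(propagate (monitored S i.+1)) -eqS.
    rewrite /= in eqS; right=> -[//|j] _; elim: j => // j IH.
    rewrite -[LHS]/(propagate (monitored S j.+1)) IH.
    apply/setUidPl/subsetP=> u; rewrite inE => /exists_inP[v vP /eqP Nv].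
    have: u \in neigh v :\: monitored S 1 by rewrite Nv set11.
    rewrite inE => /andP[/negP uN uv]; case: uN.
    apply/bigcupP; exists v; last by rewrite setU1r.
    by rewrite eqS.
  by move=> ltS; left; apply: leq_ltn_trans ltS.
- by right=> j lij; rewrite !stab // ltnW.
Qed.

Lemma power_dominatingP S :
  reflect (S != set0 /\ exists t, monitored S t = [set: G])
          (power_dominating S).
Proof.
apply: (iffP andP) => -[S0 Pt]; split=> //.
  by have [t /eqP] := existsP Pt; exists t.
case: Pt => t Pt; apply/existsP; have [ltG|leG] := leqP t #|G|.
  by exists (Ordinal (ltG : t < #|G|.+1)); apply/eqP.
exists ord_max; apply/eqP => /=.
have [|stab] := monitored_growth #|G| S0; first by rewrite ltnNge max_card.
by rewrite -Pt (stab t (ltnW leG)).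
Qed.

Definition min_power_dominating S : bool :=
  power_dominating S && [forall T, power_dominating T ==> (#|S| <= #|T|)].

Definition min_pds := {S : {set G} | min_power_dominating S}.

Definition tj_edge : rel min_pds :=
  [rel S T : min_pds | (#|val S :\: val T| == 1) && (#|val T :\: val S| == 1)].

Lemma tj_edge_sym : symmetric tj_edge.
Proof. by move=> S T; rewrite /tj_edge /= andbC. Qed.

Lemma tj_edge_irrefl : irreflexive tj_edge.
Proof. by move=> S; rewrite /tj_edge /= setDv cards0. Qed.

Definition tj_graph : sgraph := SGraph tj_edge_sym tj_edge_irrefl.
End PowerDomination.

(* Main.v *)
Require Import Defs.
From mathcomp Require Import all_boot.
From mathcomp Require Import zify.

Set Implicit Arguments.
Unset Strict Implicit.
Unset Printing Implicit Defensive.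

(** Why the reconfiguration graph is disconnected.

    A minimum power dominating set of the grid lies entirely in the six
    leftmost columns or entirely in the six rightmost ones
    ([dominating_sides]).  As there are at least twelve columns, these two
    regions are disjoint.  A token jump keeps one of the two vertices in place,
    so it cannot go from one kind to the other ([tj_on_left]).  Both kinds
    exist: the rows 2 and 4 of columns 1 and 2 form a power dominating pair
    ([left_pair_spreads]), and so does the mirror image of this pair
    ([right_pair_spreads]).

    The argument rests on a dual description of power domination.  A set [M]
    of cells is stalled when no cell of [M] has exactly one neighbour outside
    [M], i.e. when propagation from [M] adds nothing.  A nonempty [S] is power
    dominating if and only if the only stalled set containing the closed
    neighbourhood of [S] is the whole grid ([power_dominating_stalledP]).  So a
    proper stalled set is a certificate that [S] fails, and to show that [S]
    succeeds one deduces that every cell belongs to an arbitrary stalled [M].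

    The main point is that a pair of vertices that is neither contained in the
    left six columns nor in the right six ones has a small local closure.  Let
    [p], [g], [q] be the number of columns to the left of the pair, the
    difference of its two column numbers, and the number of columns to its
    right.  When [g] is at most 2, the closure stays within three columns of
    the pair, and [p] and [q] are at least 4; when [g = 3], one column is
    enough, and [p] and [q] are at least 3; when [g] is larger, the two closed
    neighbourhoods hardly grow (only at a corner of the grid), and do not meet.
    In all cases, as soon as one of the three distances is large, it contains a
    column without any monitored cell, and such a column can be repeated any
    number of times without destroying stalledness ([widen_trap]).  This
    reduces all grid widths to seventeen shapes [(p, g, q)], for which the
    closures are computed ([shapes_stall]).

    Finally, no single vertex is power dominating: together with a vertex of
    the first or of the last column it would be a power dominating pair, so it
    would be close to both ends of the grid ([power_dominating_card_ge2]). *)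

(** * Cells, unmonitored neighbours and stalled sets *)

Definition cell : Type := nat * nat.

Definition in_grid (a b : nat) (c : cell) : bool := (c.1 < a) && (c.2 < b).

Definition adj (c d : cell) : bool :=
  (c.1 == d.1) && ((c.2.+1 == d.2) || (d.2.+1 == c.2))
  || (c.2 == d.2) && ((c.1.+1 == d.1) || (d.1.+1 == c.1)).

Definition neighbours (a b : nat) (c : cell) : seq cell :=
  let: (i, j) := c in
  nseq (0 < i) (i.-1, j) ++ nseq (i.+1 < a) (i.+1, j)
    ++ nseq (0 < j) (i, j.-1) ++ nseq (j.+1 < b) (i, j.+1).

Definition whites (a b : nat) (M : pred cell) (c : cell) : nat :=
  count (predC M) (neighbours a b c).

Definition stalled (a b : nat) (M : pred cell) : Prop :=
  forall c, in_grid a b c -> M c -> whites a b M c != 1.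

Definition covered (a b : nat) (M : pred cell) (c : cell) : bool :=
  M c && (whites a b M c == 0).

Lemma mem_neighbours a b c d : in_grid a b c ->
  (d \in neighbours a b c) = in_grid a b d && adj c d.
Proof.
case: c d => [i j] [i' j']; rewrite /in_grid /adj /= => /andP[ia jb].
rewrite !mem_cat !mem_nseq !xpair_eqE !lt0b.
apply/idP/idP.
  by case/or4P=> /and3P[lt /eqP-> /eqP->]; lia.
move=> /andP[/andP[ia' jb'] /orP[]/andP[/eqP e /orP[]/eqP e']];
  apply/or4P; [apply: Or44|apply: Or43|apply: Or42|apply: Or41]; lia.
Qed.

Lemma uniq_neighbours a b c : uniq (neighbours a b c).
Proof.
case: c => i j; rewrite /neighbours !cat_uniq.
have nseqU n (x : cell) : n <= 1 -> uniq (nseq n x) by case: n => [|[]].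
rewrite !nseqU ?leq_b1 //= !andbT -!all_predC.
by apply/and3P; split; apply/allP => -[i' j'];
  rewrite /= ?mem_cat !mem_nseq !xpair_eqE ?lt0b;
  do 2?[case/orP]; case/and3P=> lt /eqP-> /eqP->; lia.
Qed.

Lemma whites0_adj a b M c d : in_grid a b c -> in_grid a b d -> adj c d ->
  whites a b M c = 0 -> M d.
Proof.
move=> gc gd cd /eqP; rewrite -leqn0 leqNgt -has_count -all_predC.
by move=> /allP/(_ d); rewrite mem_neighbours // gd cd /= negbK; apply.
Qed.

Lemma covered_adj a b M c d : covered a b M c -> in_grid a b c ->
  in_grid a b d -> (d == c) || adj c d -> M d.
Proof.
move=> /andP[Mc /eqP W] gc gd /orP[/eqP-> //|cd].
exact: whites0_adj gc gd cd W.
Qed.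

Lemma leq_whites a b (M M' : pred cell) c : in_grid a b c ->
  (forall d, in_grid a b d -> M d -> M' d) -> whites a b M' c <= whites a b M c.
Proof.
move=> gc sub; rewrite /whites -!size_filter; apply: uniq_leq_size.
  exact: filter_uniq (uniq_neighbours _ _ _).
move=> d; rewrite !mem_filter mem_neighbours // => /and3P[/= Md gd ->].
by rewrite gd !andbT; apply: contra Md; apply: sub.
Qed.

Lemma whites1P a b M c : in_grid a b c ->
  reflect (exists2 d, [&& in_grid a b d, adj c d & ~~ M d] &
     forall d', in_grid a b d' -> adj c d' -> ~~ M d' -> d' = d)
    (whites a b M c == 1).
Proof.
move=> gc; rewrite /whites -size_filter.
set s := filter _ _.
have sE d : (d \in s) = [&& in_grid a b d, adj c d & ~~ M d].
  by rewrite mem_filter mem_neighbours //= andbC andbA.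
apply: (iffP idP) => [|[d dP dU]].
  case Es: s => [|d [|? ?]] // _; exists d => [|d' gd' cd' Md'].
    by rewrite -sE Es mem_head.
  by apply/eqP; rewrite -mem_seq1 -Es sE gd' cd'.
have /perm_size-> // : perm_eq s [:: d].
apply: uniq_perm => // [|d']; first exact: filter_uniq (uniq_neighbours _ _ _).
rewrite sE inE; apply/idP/eqP => [/and3P[]|-> //]; exact: dU.
Qed.

(** The forcing rule, read inside a stalled set: since exactly one missing
    neighbour is excluded, at most one means none. *)
Lemma stalled_force a b M c : stalled a b M -> in_grid a b c -> M c ->
  whites a b M c <= 1 -> forall d, in_grid a b d -> adj c d -> M d.
Proof.
move=> stM gc Mc W1 d gd cd; apply: (whites0_adj gc gd cd).
by apply/eqP; have := stM c gc Mc; case: (whites _ _ _ _) W1 => [|[]].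
Qed.

(** * Power domination in terms of stalled sets *)

Section PowerDominationStalled.
Variables a b : nat.
Implicit Types (S : {set grid a b}) (v : grid a b).

Definition coords v : cell := (nat_of_ord v.1, nat_of_ord v.2).

Lemma coords_in v : in_grid a b (coords v).
Proof. by rewrite /in_grid !ltn_ord. Qed.

Lemma coords_inj : injective coords.
Proof. by move=> [i j] [i' j'] [/val_inj-> /val_inj->]. Qed.

Lemma coords_onto c : in_grid a b c -> {v | coords v = c}.
Proof. by case: c => i j /andP[/= ia jb]; exists (Ordinal ia, Ordinal jb). Qed.

Lemma edge_adj u v : edge u v = adj (coords u) (coords v).
Proof. by []. Qed.

(** By induction on the step, the monitored set never leaves a stalled set that
    covers [S].  Conversely the final monitored set is itself stalled and
    covers [S], so it is the whole grid if all such sets are. *)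
Lemma power_dominating_stalledP S : S != set0 ->
  power_dominating S <->
  (forall M, stalled a b M -> (forall v, v \in S -> covered a b M (coords v)) ->
     forall v, M (coords v)).
Proof.
move=> S0; split.
  case/power_dominatingP => _ [t Mt] M stM covM v.
  have: v \in monitored S t by rewrite Mt inE.
  move: v {Mt}; elim: t => [|[_|t IH]] v.
  - by move=> /covM/andP[].
  - case/bigcupP=> u /covM/andP[Mu /eqP Wu]; rewrite !inE => /orP[/eqP->//|uv].
    exact: whites0_adj (coords_in u) (coords_in v) uv Wu.
  - rewrite /= inE => /orP[/IH//|]; rewrite inE => /exists_inP[u uP /eqP Nu].
    (* A forced vertex outside [M] would be the only neighbour of [u] outside
       [M], because the monitored set is contained in [M]. *)
    apply/negPn/negP => Mv.
    have /negP[] := stM _ (coords_in u) (IH _ uP).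
    have : v \in neigh u :\: monitored S t.+1 by rewrite Nu set11.
    rewrite !inE => /andP[_ uv].
    apply/whites1P; first exact: coords_in.
    exists (coords v) => [|d gd ud Md]; first by rewrite coords_in Mv andbT.
    have [w wd] := coords_onto gd; rewrite -wd in ud Md *.
    congr coords; apply/set1P; rewrite -Nu !inE edge_adj ud andbT.
    by apply: contra Md; apply: IH.
move=> full; apply/power_dominatingP; split=> //; exists #|grid a b|.
set P := monitored S _.
have N0 : 0 < #|grid a b|.
  by apply/card_gt0P; have /set0Pn[v _] := S0; exists v.
have fixP : propagate P = P.
  have [|/(_ #|grid a b|.+1 (leqnSn _))] := monitored_growth #|grid a b| S0.
    by rewrite ltnNge max_card.
  by rewrite /P; case: #|grid a b| N0.
have S1P : monitored S 1 \subset P.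
  rewrite /P; elim: #|grid a b| N0 => // -[|n] IH _ //.
  exact: subset_trans (IH _) (monitored_sub _ _).
pose M c := [exists v in P, coords v == c].
have ME v : M (coords v) = (v \in P).
  apply/exists_inP/idP => [[u uP /eqP/coords_inj<-] //|vP]; by exists v.
apply/setP => v; rewrite inE -ME; apply: full => [c gc Mc|u uS].
- apply/negP => /(whites1P _ gc)[d].
  have [u uc] := coords_onto gc; rewrite -uc in gc Mc *.
  move=> /and3P[gd]; have [w wd] := coords_onto gd; rewrite -{}wd {d gd}.
  rewrite -edge_adj ME => uw wP wU; case/negP: (wP).
  rewrite -fixP !inE; apply/orP; right; apply/exists_inP.
  exists u; first by rewrite -ME.
  apply/eqP/setP => w'; rewrite !inE; apply/andP/eqP => [[w'P uw']|-> //].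
  by apply/coords_inj/wU; rewrite ?coords_in // ME.
- have nbP w : (w == u) || edge u w -> w \in P.
    move=> uw; apply: (subsetP S1P); apply/bigcupP; exists u => //.
    by rewrite !inE.
  rewrite /covered ME nbP ?eqxx //= -leqn0 leqNgt -has_count -all_predC.
  apply/allP => d; rewrite mem_neighbours ?coords_in // => /andP[gd].
  have [w wd] := coords_onto gd; rewrite -wd /= negbK ME => uw.
  by apply: nbP; rewrite edge_adj uw orbT.
Qed.

End PowerDominationStalled.

(** * Computing closures on Boolean tables *)

Definition tabulate (a b : nat) (f : cell -> bool) : seq (seq bool) :=
  mkseq (fun i => mkseq (fun j => f (i, j)) b) a.

Definition lookup (m : seq (seq bool)) (c : cell) : bool :=
  nth false (nth [::] m c.1) c.2.

Lemma lookup_tabulate a b f c :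
  lookup (tabulate a b f) c = in_grid a b c && f c.
Proof.
case: c => i j; rewrite /lookup /tabulate /in_grid /=.
case: (ltnP i a) => ia; last by rewrite (nth_default [::]) ?nth_nil ?size_mkseq.
rewrite nth_mkseq //; case: (ltnP j b) => jb; last first.
  by rewrite nth_default ?size_mkseq.
by rewrite nth_mkseq.
Qed.

(* Below, [if] replaces the Boolean connectives because it is lazy: most cells
   of the tables are unmonitored and need no further work. *)

(** One round of forcing in the grid with [b] columns, recorded only in its
    first [w] columns: the other columns are treated as unmonitored, so the
    result is a lower bound for the closure. *)
Definition force (a b w : nat) (m : seq (seq bool)) : seq (seq bool) :=
  let active := tabulate a w (fun c =>
    if lookup m c then whites a b (lookup m) c == 1 else false) in
  tabulate a w (fun c =>
    if lookup m c then true else has (lookup active) (neighbours a b c)).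

Definition seed (a w : nat) (c d : cell) : seq (seq bool) :=
  tabulate a w (fun e => [|| e == c, e == d, adj c e | adj d e]).

Definition quiet (a b : nat) (m : seq (seq bool)) : bool :=
  all (fun i => all (fun j =>
    if lookup m (i, j) then whites a b (lookup m) (i, j) != 1 else true)
    (iota 0 b)) (iota 0 a).

Fixpoint closure (a b n : nat) (m : seq (seq bool)) : seq (seq bool) :=
  if n is n'.+1 then
    if quiet a b m then m else closure a b n' (force a b b m)
  else m.

Definition empty_column (a : nat) (m : seq (seq bool)) (j : nat) : bool :=
  all (fun i => ~~ lookup m (i, j)) (iota 0 a).

Lemma quiet_stalled a b m : quiet a b m -> stalled a b (lookup m).
Proof.
move=> /allP qm [i j] /andP[/= ia jb] mij.
have /= := qm i; rewrite mem_iota => /(_ ia) /allP/(_ j) /=.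
by rewrite mem_iota mij; apply.
Qed.

(** * Pairs that do not dominate: seventeen shapes *)

(** Any two vertices in columns [p] and [p + g] of the grid with
    [(p + g + q).+1] columns are covered by a stalled set with empty columns at
    the places where [straddling_trap] has to insert columns: at the left end
    if [1 < p], halfway between the two vertices if [3 < g], at the right end
    if [1 < q].  The stalled set is computed as a closure; it is checked to be
    stalled afterwards, so the number of rounds need only be large enough. *)
Definition shape_stalls (a p g q : nat) : bool :=
  let b := (p + g + q).+1 in
  all (fun i => all (fun i' =>
    let c := (i, p) in let d := (i', p + g) in
    let m := closure a b 20 (seed a b c d) in
    [&& quiet a b m, covered a b (lookup m) c, covered a b (lookup m) d,
        (1 < p) ==> empty_column a m 0,
        (3 < g) ==> empty_column a m (p + g./2) &
        (1 < q) ==> empty_column a m (p + g + q)]) (iota 0 a)) (iota 0 a).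

(** The distances 4 and 3 in the first four shapes leave an empty column at each
    end.  With [g = 4] there is an empty column halfway unless a vertex lies in
    the first or last column, where a corner may add a column to its closure;
    but then the other vertex is at least six columns away. *)
Definition shapes : seq (nat * nat * nat) :=
  [:: (4, 0, 4); (4, 1, 4); (4, 2, 4); (3, 3, 3)]
    ++ [seq (p, 4, q) | p <- iota 1 2, q <- iota 1 2]
    ++ [seq (p, 6, q) | p <- iota 0 3, q <- iota 0 3].

Lemma shapes_stall :
  all (fun a => all (fun t => shape_stalls a t.1.1 t.1.2 t.2) shapes)
    [:: 5; 6; 7; 8].
Proof. by vm_compute. Qed.

Definition empty_at (a : nat) (M : pred cell) (k : nat) : Prop :=
  forall i, i < a -> ~~ M (i, k).

Definition trap (a b : nat) (M : pred cell) (c d : cell) : Prop :=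
  [/\ stalled a b M, covered a b M c & covered a b M d].

Lemma shape_trap a i i' t : a \in [:: 5; 6; 7; 8] -> i < a -> i' < a ->
  t \in shapes ->
  let: (p, g, q) := t in
  exists M, [/\ trap a (p + g + q).+1 M (i, p) (i', p + g),
    1 < p -> empty_at a M 0, 3 < g -> empty_at a M (p + g./2) &
    1 < q -> empty_at a M (p + g + q)].
Proof.
move=> ha ia ia' tin.
have /allP sz := shapes_stall; have /allP chk := sz _ ha.
have /allP rowi := chk _ tin; case: t tin rowi {sz chk} => [[p g] q] _ rowi.
have := rowi i; rewrite mem_iota => /(_ ia) /allP rowi'.
have := rowi' i'; rewrite mem_iota => /(_ ia') {rowi rowi'}.
cbv beta zeta; set m := closure _ _ _ _.
have emptyP j : empty_column a m j -> empty_at a (lookup m) j.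
  by move=> /allP E k ka; apply: E; rewrite mem_iota.
case/and5P => /quiet_stalled stm cx cy /implyP Ep /andP[/implyP Eg /implyP Eq].
by exists (lookup m); split; auto.
Qed.

(** * Widening a stalled set at an empty column *)

Definition pull (f : nat -> nat) (M : pred cell) : pred cell :=
  fun c => M (c.1, f c.2).

(** Near column [j], [f] is a translation that respects the borders of the
    grids with [b'] and [b] columns. *)
Definition step_preserving (b b' : nat) (f : nat -> nat) (j : nat) : Prop :=
  [/\ (0 < f j) = (0 < j), (f j).+1 < b = (j.+1 < b'),
      0 < j -> f j.-1 = (f j).-1 & j.+1 < b' -> f j.+1 = (f j).+1].

Lemma whites_pull a b b' f M i j : step_preserving b b' f j ->
  whites a b' (pull f M) (i, j) = whites a b M (i, f j).
Proof.
case=> E0 E1 Ep Es; rewrite /whites /= !count_cat !count_nseq /pull /= E0 E1.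
by case: (0 < j) Ep => [->|_] //; case: (j.+1 < b') Es => [->|_];
  rewrite ?muln0.
Qed.

(** Stalledness is a condition on the cells of the set only, so [f] may be
    arbitrary at the columns that it maps to an empty column. *)
Lemma stalled_pull a b b' f M : stalled a b M ->
  (forall j, j < b' -> f j < b) ->
  (forall j, j < b' -> empty_at a M (f j) \/ step_preserving b b' f j) ->
  stalled a b' (pull f M).
Proof.
move=> stM fb loc [i j] /andP[/= ia jb]; rewrite {1}/pull /= => Mij.
case: (loc j jb) => [/(_ i ia)/negP//|fj]; rewrite (@whites_pull a b) //.
by apply: stM; rewrite // /in_grid /= ia fb.
Qed.

Lemma covered_pull a b b' f M i j : step_preserving b b' f j ->
  covered a b' (pull f M) (i, j) = covered a b M (i, f j).
Proof. by move=> fj; rewrite /covered (@whites_pull a b). Qed.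

(** The map that sends the columns [k], ..., [k + n] to [k] and shifts the later
    ones to the left by [n]: pulling back along it repeats column [k] [n]
    times. *)
Definition collapse (k n j : nat) : nat := minn j k + (j - (k + n)).

(** An empty column can be repeated: the cells next to it see the same
    neighbours as before.  The case [n = 0] spares the users a case
    distinction. *)
Lemma widen_trap a b M k n i i' x x' y y' :
  k < b -> n = 0 \/ empty_at a M k -> i < a -> i' < a ->
  x' < b + n -> y' < b + n -> collapse k n x' = x -> collapse k n y' = y ->
  trap a b M (i, x) (i', y) ->
  trap a (b + n) (pull (collapse k n) M) (i, x') (i', y').
Proof.
move=> kb empty ia ia' xb yb <- <- [stM cx cy].
have fb j : j < b + n -> collapse k n j < b by rewrite /collapse; lia.
have loc j : j < b + n -> empty_at a M (collapse k n j) \/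
    step_preserving b (b + n) (collapse k n) j.
  case: empty => [n0|empty] jb.
    by right; rewrite /step_preserving /collapse; split; lia.
  have [->|nk] := eqVneq (collapse k n j) k; first by left.
  by right; move: nk; rewrite /step_preserving /collapse; split; lia.
(* A covered cell lies in a nonempty column, so only the second case of [loc]
   is possible there. *)
have cov r j : r < a -> j < b + n -> covered a b M (r, collapse k n j) ->
    covered a (b + n) (pull (collapse k n) M) (r, j).
  move=> ra jb crj; rewrite (@covered_pull a b) //.
  by case: (loc j jb) => // /(_ r ra)/negP[]; case/andP: crj.
split; [exact: stalled_pull stM fb loc | exact: cov | exact: cov].
Qed.

(** A pair with a vertex beyond the first six columns and a vertex before the
    last six ones arises from one of the [shapes] by repeating empty columns at
    the left end, between the vertices and at the right end. *)
Lemma straddling_trap a b i i' x y : a \in [:: 5; 6; 7; 8] -> 12 <= b ->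
  i < a -> i' < a -> x <= y -> y < b -> 6 <= y -> x + 7 <= b ->
  exists2 M, trap a b M (i, x) (i', y) & exists2 c, in_grid a b c & ~~ M c.
Proof.
move=> ha hb ia ia' xy yb y6 xb.
(* [fits u0 u k]: the distance [u0] of the shape is the actual distance [u], or
   can be enlarged to it because [k < u0] provides an empty column. *)
pose fits (u0 u k : nat) := (u0 == u) || (k < u0 <= u).
have [[[p g] q] [tin /= fp fg fq]] : exists t, [/\ t \in shapes,
    fits t.1.1 x 1, fits t.1.2 (y - x) 3 & fits t.2 (b.-1 - y) 1].
  have [lt3|ge3] := leqP (y - x) 2.
    exists (4, y - x, 4); rewrite /fits /=; split; try lia.
    by case: (y - x) lt3 => [|[|[|]]].
  have [eq3|ne3] := eqVneq (y - x) 3.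
    by exists (3, 3, 3); rewrite /fits /=; split; try lia.
  exists (minn x 2, if y - x < 6 then 4 else 6, minn (b.-1 - y) 2).
  rewrite /fits /=; split; try lia.
  - case: ltnP => g6.
      have: 0 < minn x 2 < 3 by lia.
      have: 0 < minn (b.-1 - y) 2 < 3 by lia.
      by case: (minn _ 2) => [|[|[|]]] //; case: (minn _ 2) => [|[|[|]]].
    have: minn x 2 < 3 by lia.
    have: minn (b.-1 - y) 2 < 3 by lia.
    by case: (minn _ 2) => [|[|[|]]] //; case: (minn _ 2) => [|[|[|]]].
  - by case: ltnP; lia.
have pos : (1 < p) || (3 < g).
  by move: tin; case: (p) => [|[|//]]; case: (g) => [|[|[|[|]]]].
have [M0 [trap0 E0 Eh Et]] := shape_trap ha ia ia' tin.
pose dp := x - p; pose dg := y - x - g; pose dq := b.-1 - y - q.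
have xE : x = p + dp by rewrite /dp; move: fp; rewrite /fits; lia.
have yE : y = p + g + dg + dp.
  by rewrite /dp /dg; move: fp fg; rewrite /fits; lia.
have bE : b = (p + g + q).+1 + dq + dg + dp.
  by rewrite /dp /dg /dq; move: fp fg fq; rewrite /fits; lia.
have {fq}eq : dq = 0 \/ 1 < q by move: fq; rewrite /fits /dq; lia.
have {fg}eg : dg = 0 \/ 3 < g by move: fg; rewrite /fits /dg; lia.
have {fp}ep : dp = 0 \/ 1 < p by move: fp; rewrite /fits /dp; lia.
move: dp dg dq xE yE bE ep eg eq.
move=> dp dg dq {xy yb y6 xb hb tin}-> -> -> ep eg eq.
have half : 3 < g -> 0 < g./2 < g by lia.
(* Working from right to left keeps the positions of the columns that are still
   to be repeated. *)
set M1 := pull (collapse (p + g + q) dq) M0.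
have trap1 : trap a ((p + g + q).+1 + dq) M1 (i, p) (i', p + g).
  apply: widen_trap trap0; rewrite ?/collapse //; try lia.
  by case: eq => [|/Et]; [left|right].
have Eh1 : 3 < g -> empty_at a M1 (p + g./2).
  move=> g3 r ra; rewrite /M1 /pull /=.
  have -> : collapse (p + g + q) dq (p + g./2) = p + g./2.
    by have := half g3; rewrite /collapse; lia.
  exact: Eh.
have E01 : 1 < p -> empty_at a M1 0.
  by move=> p1 r ra; rewrite /M1 /pull /collapse /= min0n; apply: E0.
set M2 := pull (collapse (p + g./2) dg) M1.
have trap2 : trap a ((p + g + q).+1 + dq + dg) M2 (i, p) (i', p + g + dg).
  apply: widen_trap trap1; rewrite ?/collapse //; try lia.
  by case: eg => [|/Eh1]; [left|right].
have E02 : 1 < p -> empty_at a M2 0.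
  by move=> p1 r ra; rewrite /M2 /pull /collapse /= min0n; apply: E01.
exists (pull (collapse 0 dp) M2).
  apply: widen_trap trap2; rewrite ?/collapse //; try lia.
  by case: ep => [|/E02]; [left|right].
have [p1|p1] := ltnP 1 p.
  exists (0, 0); first by rewrite /in_grid /=; lia.
  by rewrite /pull /collapse /=; apply: E02; lia.
have g3 : 3 < g by lia.
have h := half g3.
exists (0, p + g./2 + dp); first by rewrite /in_grid /=; lia.
rewrite /pull /=.
have -> : collapse 0 dp (p + g./2 + dp) = p + g./2 by rewrite /collapse; lia.
rewrite /M2 /pull /=.
have -> : collapse (p + g./2) dg (p + g./2) = p + g./2 by rewrite /collapse; lia.
by apply: Eh1 => //; lia.
Qed.

(** * Pairs that dominate *)

(** Within the first [w] columns forcing does not depend on the number of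
    columns of the grid, so it can be computed with [w.+1] columns. *)
Lemma force_sub a b w M m : w < b -> stalled a b M ->
  (forall c, lookup m c -> in_grid a w c && M c) ->
  forall c, lookup (force a w.+1 w m) c -> in_grid a w c && M c.
Proof.
move=> wb stM sub c; rewrite lookup_tabulate => /andP[gc].
rewrite gc /=; case: ifP => [/sub/andP[]//|_ /hasP[d]].
have widen e : in_grid a w e -> in_grid a b e && in_grid a w.+1 e.
  by rewrite /in_grid; lia.
have /andP[gcb gcw] := widen c gc.
rewrite mem_neighbours // => /andP[gdw cd].
rewrite lookup_tabulate => /andP[gd]; case: ifP => // md /eqP W1.
have /andP[gdb _] := widen d gd; have /andP[_ Md] := sub d md.
have dc : adj d c by move: cd; rewrite /adj; lia.
apply: (stalled_force stM gdb Md) => //; rewrite -W1.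
have -> : whites a w.+1 (lookup m) d = whites a b (lookup m) d.
  case: (d) gd => k l /andP[_ /= lw]; rewrite /whites /neighbours ltnS lw.
  by have -> : l.+1 < b by lia.
by apply: leq_whites => // e _ /sub/andP[].
Qed.

(** The slowest case, [a = 8], takes ten rounds. *)
Lemma left_pair_fills_six_columns :
  all (fun a => let m := iter 12 (force a 7 6) (seed a 6 (2, 1) (4, 2)) in
    all (fun i => all (fun j => lookup m (i, j)) (iota 0 6)) (iota 0 a))
  [:: 5; 6; 7; 8].
Proof. by vm_compute. Qed.

(** Two full consecutive columns force the next one, as each cell of the second
    one misses at most its right neighbour. *)
Lemma stalled_fill a b M k : stalled a b M -> 1 < k ->
  (forall i j, i < a -> j < k -> j < b -> M (i, j)) ->
  forall c, in_grid a b c -> M c.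
Proof.
move=> stM k1 base [i j] /andP[/=]; elim/ltn_ind: j i => j IH i ia jb.
have [jk|kj] := ltnP j k; first exact: base.
have gc : in_grid a b (i, j.-1) by rewrite /in_grid /=; lia.
apply: (stalled_force stM gc); rewrite ?IH //; try lia.
- rewrite leqNgt; apply/negP => W2.
  have : whites a b M (i, j.-1) <= size [:: (i, j)].
    rewrite /whites -size_filter; apply: uniq_leq_size.
      exact: filter_uniq (uniq_neighbours _ _ _).
    move=> [i' j']; rewrite mem_filter mem_neighbours // => /and3P[/= Md].
    move=> /andP[/= ia' jb'] cd; rewrite inE; apply: contraNT Md => ne.
    by apply: IH => //; move: ne cd; rewrite /adj xpair_eqE /=; lia.
  by rewrite leqNgt W2.
- by rewrite /in_grid /=; lia.
- by rewrite /adj /=; lia.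
Qed.

Lemma left_pair_spreads a b M : a \in [:: 5; 6; 7; 8] -> 12 <= b ->
  stalled a b M -> covered a b M (2, 1) -> covered a b M (4, 2) ->
  forall c, in_grid a b c -> M c.
Proof.
move=> ha hb stM cov1 cov2.
have a5 : 4 < a by move: ha; rewrite !inE; lia.
apply: (stalled_fill stM (k := 6)) => // i j ia j6 _.
have sub n c : lookup (iter n (force a 7 6) (seed a 6 (2, 1) (4, 2))) c ->
    in_grid a 6 c && M c.
  elim: n c => [c|n IH c]; last by apply: (@force_sub a b) => //; lia.
  rewrite /= lookup_tabulate => /andP[gc]; rewrite gc /= => sc.
  have gb : in_grid a b c by move: gc; rewrite /in_grid; lia.
  have : ((c == (2, 1)) || adj (2, 1) c) || ((c == (4, 2)) || adj (4, 2) c).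
    by move: sc => /or4P[->|->|->|->]; rewrite ?orbT.
  by case/orP; [move: cov1 | move: cov2] => /covered_adj; apply=> //;
    rewrite /in_grid /=; lia.
have /allP spa := left_pair_fills_six_columns; have /allP rows := spa _ ha.
have := rows i; rewrite mem_iota => /(_ ia)/allP row.
by have := row j; rewrite mem_iota => /(_ j6)/sub/andP[].
Qed.

Lemma whites_mirror a b M i j : j < b ->
  whites a b (pull (fun j => b.-1 - j) M) (i, j) = whites a b M (i, b.-1 - j).
Proof.
move=> jb; rewrite /whites /= !count_cat !count_nseq /pull /=.
have -> : (0 < b.-1 - j) = (j.+1 < b) by lia.
have -> : ((b.-1 - j).+1 < b) = (0 < j) by lia.
have -> : b.-1 - j.+1 = (b.-1 - j).-1 by lia.
congr (_ + (_ + _)); rewrite addnC; congr (_ + _).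
case: ltnP => // lt; rewrite ?muln0 //.
by have -> : b.-1 - j.-1 = (b.-1 - j).+1 by lia.
Qed.

Lemma right_pair_spreads a b M : a \in [:: 5; 6; 7; 8] -> 12 <= b ->
  stalled a b M -> covered a b M (2, b - 2) -> covered a b M (4, b - 3) ->
  forall c, in_grid a b c -> M c.
Proof.
move=> ha hb stM cov1 cov2 [i j] /andP[/= ia jb].
have mirK k : k < b -> b.-1 - (b.-1 - k) = k by lia.
rewrite -(mirK j jb) -[M _]/(pull (fun j => b.-1 - j) M (i, b.-1 - j)).
apply: (left_pair_spreads ha hb); last by rewrite /in_grid /=; lia.
- move=> [i' j'] /andP[/= ia' jb']; rewrite whites_mirror // => Mc.
  by apply: stM => //; rewrite /in_grid /=; lia.
- rewrite /covered whites_mirror; last by lia.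
  by rewrite /pull /= (_ : b.-1 - 1 = b - 2) //; lia.
- rewrite /covered whites_mirror; last by lia.
  by rewrite /pull /= (_ : b.-1 - 2 = b - 3) //; lia.
Qed.

(** * Minimum power dominating sets lie near one end of the grid *)

Lemma straddling_not_dominating a b (S : {set grid a b}) (x y : grid a b) :
  a \in [:: 5; 6; 7; 8] -> 12 <= b -> S \subset [set x; y] ->
  x.2 + 7 <= b -> 6 <= y.2 -> ~~ power_dominating S.
Proof.
move=> ha hb.
wlog xy : x y / x.2 <= y.2.
  move=> wl Sxy xb y6; have [le|lt] := leqP x.2 y.2; first exact: (wl x y).
  by apply: (wl y x); rewrite 1?setUC ?(ltnW lt) //; lia.
move=> Sxy xb y6; apply/negP => PS.
have S0 : S != set0 by case/andP: PS.
have [M [stM cx cy] [c gc Mc]] := straddling_trap ha hb (ltn_ord x.1)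
  (ltn_ord y.1) xy (ltn_ord y.2) y6 xb.
have [v vc] := coords_onto gc.
move: Mc; rewrite -vc => /negP; apply.
apply: ((power_dominating_stalledP S0).1 PS) => // u /(subsetP Sxy).
by rewrite !inE => /orP[]/eqP->.
Qed.

Lemma dominating_sides a b (S : {set grid a b}) (x y : grid a b) :
  a \in [:: 5; 6; 7; 8] -> 12 <= b ->
  power_dominating S -> S \subset [set x; y] ->
  (x.2 < 6) && (y.2 < 6) || (b <= x.2 + 6) && (b <= y.2 + 6).
Proof.
move=> ha hb PS Sxy.
have := straddling_not_dominating ha hb Sxy.
have := @straddling_not_dominating a b S y x ha hb; rewrite setUC => /(_ Sxy).
by rewrite PS; lia.
Qed.

(** A power dominating vertex [x] could be paired with any other vertex.  Taken
    in the first column, that vertex shows that [x] is near the left end; taken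
    in the last column, that [x] is near the right end. *)
Lemma power_dominating_card_ge2 a b (S : {set grid a b}) :
  a \in [:: 5; 6; 7; 8] -> 12 <= b -> power_dominating S -> 2 <= #|S|.
Proof.
move=> ha hb PS; rewrite ltnNge; apply/negP => S1.
have /set0Pn[x xS] : S != set0 by case/andP: PS.
have Sx y : S \subset [set x; y].
  apply/subsetP => z zS; rewrite !inE; apply/orP; left.
  by have /card_le1_eqP eqS := S1; rewrite (eqS z x).
have col j : j < b -> {y : grid a b | coords y = (x.1 : nat, j)}.
  by move=> jb; apply: coords_onto; rewrite /in_grid ltn_ord.
have [y [_ y2]] : {y : grid a b | coords y = (x.1 : nat, 0)}.
  by apply: col; lia.
have [z [_ z2]] : {z : grid a b | coords z = (x.1 : nat, b.-1)}.
  by apply: col; lia.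
have := dominating_sides ha hb PS (Sx y).
by have := dominating_sides ha hb PS (Sx z); rewrite y2 z2; lia.
Qed.

Lemma min_power_dominating_pair a b (x y : grid a b) :
  a \in [:: 5; 6; 7; 8] -> 12 <= b ->
  (forall M, stalled a b M -> covered a b M (coords x) ->
     covered a b M (coords y) -> forall c, in_grid a b c -> M c) ->
  min_power_dominating [set x; y].
Proof.
move=> ha hb full.
have PS : power_dominating [set x; y].
  apply/power_dominating_stalledP; first by apply/set0Pn; exists x; rewrite set21.
  move=> M stM cov v; apply: full (coords_in v) => //; apply: cov.
    exact: set21.
  exact: set22.
rewrite /min_power_dominating PS; apply/forall_inP => T PT.
apply: leq_trans (power_dominating_card_ge2 ha hb PT).
by rewrite cards2; case: (x != y).
Qed.

(** * Token jumps preserve the side *)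

Definition on_left (a b : nat) (S : {set grid a b}) : bool :=
  [forall v in S, v.2 < 6].

Lemma tj_on_left a b (S T : min_pds (grid a b)) :
  a \in [:: 5; 6; 7; 8] -> 12 <= b -> #|val T| = 2 ->
  tj_edge S T -> on_left (val S) -> on_left (val T).
Proof.
move=> ha hb /eqP/cards2P[x [y [_ Txy]]] /andP[/eqP SDT _] /forall_inP SL.
have PT : power_dominating (val T) by case/andP: (valP T).
have PS : power_dominating (val S) by case/andP: (valP S).
(* The common vertex of [S] and [T] decides the side of [T]. *)
have /set0Pn[v] : val S :&: val T != set0.
  rewrite -card_gt0; have := cardsID (val T) (val S); rewrite SDT.
  by have := power_dominating_card_ge2 ha hb PS; lia.
rewrite inE => /andP[/SL v6 vT].
have Tsub : val T \subset [set x; y] by rewrite Txy.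
have sides := dominating_sides ha hb PT Tsub.
have xyT w : w \in val T -> w = x \/ w = y.
  by move/(subsetP Tsub); rewrite !inE => /orP[]/eqP->; [left|right].
have vxy := xyT v vT; apply/forall_inP => w /xyT wxy.
by move: v6; case: vxy => ->; case: wxy => ->; lia.
Qed.

Theorem proposition5p12 (a b : nat) (ha : a \in [:: 5; 6; 7; 8])
    (hb : 12 <= b) :
  disconnected (tj_graph (grid a b)).
Proof.
have a5 : 4 < a by move: ha; rewrite !inE; lia.
have vertex_at i j : i < a -> j < b -> {v : grid a b | coords v = (i, j)}.
  by move=> ia jb; apply: coords_onto; rewrite /in_grid ia.
have [l1 l1E] : {v : grid a b | coords v = (2, 1)} by apply: vertex_at; lia.
have [l2 l2E] : {v : grid a b | coords v = (4, 2)} by apply: vertex_at; lia.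
have [r1 r1E] : {v : grid a b | coords v = (2, b - 2)} by apply: vertex_at; lia.
have [r2 r2E] : {v : grid a b | coords v = (4, b - 3)} by apply: vertex_at; lia.
have minL : min_power_dominating [set l1; l2].
  apply: min_power_dominating_pair => // M; rewrite l1E l2E.
  exact: left_pair_spreads.
have minR : min_power_dominating [set r1; r2].
  apply: min_power_dominating_pair => // M; rewrite r1E r2E.
  exact: right_pair_spreads.
have card2 (T : min_pds (grid a b)) : #|val T| = 2.
  case/andP: (valP T) => PT /forall_inP/(_ [set l1; l2]).
  case/andP: minL => PL _ /(_ PL); rewrite cards2 => T2.
  by have := power_dominating_card_ge2 ha hb PT; case: (l1 != l2) T2 => /=; lia.
pose L : min_pds (grid a b) := Sub [set l1; l2] minL.
pose R : min_pds (grid a b) := Sub [set r1; r2] minR.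
have leftL : on_left (val L).
  apply/forall_inP => v; rewrite !inE => /orP[]/eqP->.
    by case: l1E => _ ->.
  by case: l2E => _ ->.
have rightR : ~~ on_left (val R).
  apply/forall_inPn; exists r1; first exact: set21.
  by move: r1E => [_ ->]; lia.
move=> /(_ L R) LR; move: rightR.
have <- : on_left (val L) = on_left (val R); last by rewrite leftL.
apply: (@closed_connect _ _ (fun S : min_pds (grid a b) => on_left (val S))
  _ _ _ LR).
apply: intro_closed => [|S T ST]; last exact: tj_on_left.
exact/sym_connect_sym/tj_edge_sym.
Qed.
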